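(* Let $k\ge2$. (1) $S(\mathrm{TEP},2)=k^2$, and it is achieved at $\ell=k+1$ and at $\ell=k+2$, i.e. $S((\mathrm{TEP},2),k+1)=S((\mathrm{TEP},2),k+2)=k^2$. (2) $S(\mathrm{TEP},3)\ge k^3/16$ for $k\ge4$. (3) $S(\mathrm{TEP},h)\le k^h-k^{h-2}(k-2)$ for $h\ge3$; in particular $S(\mathrm{TEP},h)<k^h$ for $h\ge3$ and $k\ge3$.
   Context: Tree Evaluation Problem: $(\mathrm{TEP},1):[k]\to[k]$ is the identity; for $h\ge2$, $(\mathrm{TEP},h):[k]^{n_h}\to[k]$, $n_h=(2^{h-1}-1)k^2+2^{h-1}$, takes as input a complete binary tree of height $h$ (a root with two leaves has height 2) whose leaves carry values in $[k]$ and whose internal nodes carry matrices in $[k]^{k\times k}$ (each entry an input variable); a leaf's value is its label, an internal node with matrix $M$ has value $M(a,b)$ where $a,b$ are its children's values, and the output is the root's value. For $A\subseteq[n_h]$, $(\mathrm{TEP},h)_A$ is the matrix with rows indexed by $\alpha\in[k]^A$, columns by assignments to $[n_h]\setminus A$, entry the value of $(\mathrm{TEP},h)$; $\mathsf{nrows}$ denotes its number of distinct rows. $S((\mathrm{TEP},h),\ell)=\min_{A\subseteq[n_h],|A|=\ell}\mathsf{nrows}((\mathrm{TEP},h)_A)$ and $S(\mathrm{TEP},h)=\max_{1\le\ell\le n_h}S((\mathrm{TEP},h),\ell)$. *)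

(* Defs.v *)
From mathcomp Require Import all_boot all_order.

Set Implicit Arguments.
Unset Strict Implicit.
Unset Printing Implicit Defensive.

Section CommunicationMatrix.

(* Functions [f : K^V -> T] of input variables indexed by [V]. *)
Variables (V K T : finType).

Definition glue (A : {set V}) (a : {ffun {x | x \in A} -> K})
    (b : {ffun {x | x \notin A} -> K}) : {ffun V -> K} :=
  [ffun x => match boolP (x \in A) with
             | AltTrue xA => a (exist _ x xA)
             | AltFalse xNA => b (exist _ x xNA)
             end].

(* The matrix [f_A]: its rows are indexed by the assignments to [A], its
   columns by the assignments to the complement of [A]. *)
Definition comm_mx (f : {ffun V -> K} -> T) (A : {set V})
    (a : {ffun {x | x \in A} -> K}) (b : {ffun {x | x \notin A} -> K}) : T :=
  f (glue a b).

Definition nrows (R C : finType) (M : R -> C -> T) : nat :=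
  #|[set [ffun c => M r c] | r : R]|.

(* The default value of the minimum bounds every [nrows] from above, so it is
   irrelevant as soon as [l <= #|V|]: see [S_atP]. *)
Definition S_at (f : {ffun V -> K} -> T) (l : nat) : nat :=
  \big[minn/#|{ffun V -> K}|]_(A : {set V} | #|A| == l) nrows (@comm_mx f A).

Definition S_max (f : {ffun V -> K} -> T) : nat :=
  \max_(1 <= l < #|V|.+1) S_at f l.

Lemma nrows_comm_mx_le (f : {ffun V -> K} -> T) (A : {set V}) :
  0 < #|K| -> nrows (@comm_mx f A) <= #|{ffun V -> K}|.
Proof.
move=> K_gt0; apply: leq_trans (leq_imset_card _ _) _.
by rewrite !card_ffun card_sig leq_pexp2l // max_card.
Qed.

Lemma S_atP (f : {ffun V -> K} -> T) (l : nat) : 0 < #|K| -> l <= #|V| ->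
  (exists2 A : {set V}, #|A| = l & S_at f l = nrows (@comm_mx f A)) /\
  (forall A : {set V}, #|A| = l -> S_at f l <= nrows (@comm_mx f A)).
Proof.
move=> K_gt0 leV.
have lb (A : {set V}) : #|A| = l -> S_at f l <= nrows (@comm_mx f A).
  move=> /eqP cA; rewrite /S_at -Order.NatOrder.minEnat.
  exact: (@Order.TotalTheory.bigmin_le_cond _ nat).
split=> //.
have [A0 cA0] : exists A : {set V}, #|A| == l.
  have /card_gt0P[A] : 0 < #|[set A : {set V} | #|A| == l]|.
    by rewrite card_draws bin_gt0.
  by rewrite inE; exists A.
case: (@arg_minnP _ A0 (fun A : {set V} => #|A| == l)
         (fun A => nrows (@comm_mx f A)) cA0) => A cA minA.
exists A; first exact/eqP.
apply/eqP; rewrite eqn_leq lb ?(eqP cA) //=.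
rewrite /S_at; elim/big_ind: _ => //; first exact: nrows_comm_mx_le.
by move=> x y lx ly; rewrite leq_min lx.
Qed.

End CommunicationMatrix.

(* The input variables of the tree of height [d.+1]: for a single leaf, its
   label; otherwise the entries of the matrix at the root, then the variables of
   the left and of the right subtree. *)
Fixpoint tree_var (k d : nat) : finType :=
  match d with
  | 0 => unit
  | d'.+1 => ('I_k * 'I_k + (tree_var k d' + tree_var k d'))%type
  end.

Fixpoint tree_eval (k d : nat) : (tree_var k d -> 'I_k) -> 'I_k :=
  match d return (tree_var k d -> 'I_k) -> 'I_k with
  | 0 => fun x => x tt
  | d'.+1 => fun x =>
      let a := @tree_eval k d' (fun v => x (inr (inl v))) in
      let b := @tree_eval k d' (fun v => x (inr (inr v))) in
      x (inl (a, b))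
  end.

(* Heights start at 1; the value at [h = 0] is irrelevant. *)
Definition tep_var (k h : nat) : finType := tree_var k h.-1.

Definition TEP (k h : nat) (x : {ffun tep_var k h -> 'I_k}) : 'I_k :=
  @tree_eval k h.-1 x.

Lemma card_tep_var (k h : nat) : 0 < h ->
  #|tep_var k h| = (2 ^ (h - 1) - 1) * k ^ 2 + 2 ^ (h - 1).
Proof.
case: h => // d _; rewrite subSS subn0 /tep_var /=.
elim: d => [|d IH]; first by rewrite card_unit.
rewrite [tree_var _ _]/= !card_sum card_prod !card_ord IH mulnn (expnS 2 d).
have : 0 < 2 ^ d by rewrite expn_gt0.
case: (2 ^ d) => // m _.
have -> : 2 * m.+1 = (m + m).+2 by rewrite mul2n -addnn addSn addnS.
rewrite !subSS !subn0 mulSn mulnDl (addnACA _ m.+1) !addnA.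
by rewrite !(addnS, addSn) !addnA.
Qed.

(* Main.v *)
(* Upper bounds: for each l one exhibits a set A of l variables, obtained by
   reading the left subtree, then the right one, then the root matrix.  Reading
   the whole left subtree leaves only its value, which costs a factor k, so
   S(h+1) <= k S(h).  The saving over k^h comes from height 3: after the left
   subtree, up to 2k-1 further variables are taken from the root matrix, at most
   two per row and only one in some row, which gives k + (k-1) k^2 rows; beyond
   that the right subtree is read, both leaves and at least 2k-2 matrix entries,
   which gives at most k (k^2 - k + 2) rows.

   Lower bounds: if a leaf below a matrix is outside A while A contains more than
   t k entries of the matrix, then fixing the sibling subtree selects a row (or
   column) with t+1 entries in A that the free leaf can probe, whence k^(t+1)
   rows.  In height 3, take l = k^2 + 2tk + 4, with t in {1,2}.  If a leaf is
   missing from A, at least two of the three matrices have at most tk entries in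
   A (all three if leaves are missing on both sides), contradicting l.  Otherwise
   all four leaves are in A, and with F, G the parts of the left and right
   matrices in A, say |G| <= |F|, the left value and the position queried in the
   right matrix give k (k^2 - |G|) rows. *)
Require Import Defs.
From mathcomp Require Import all_boot all_order all_algebra.
From mathcomp Require Import zify.

Lemma exists_subset {T : finType} (B : {set T}) (n : nat) : n <= #|B| ->
  exists2 A : {set T}, A \subset B & #|A| = n.
Proof.
rewrite -bin_gt0 -cards_draws => /card_gt0P[A].
by rewrite inE => /andP[AB /eqP An]; exists A.
Qed.

(** * Counting distinct rows through total assignments *)

Section Rows.
Set Implicit Arguments.
Unset Strict Implicit.

(* Total assignments avoid the sigma types of [glue]; only the values of [x] on
   [A] and of [z] off [A] matter. *)
Definition mix (V K : finType) (A : {set V}) (x z : V -> K) : {ffun V -> K} :=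
  [ffun v => if v \in A then x v else z v].

Definition row_of (V K T : finType) (f : {ffun V -> K} -> T) (A : {set V})
    (x : V -> K) : {ffun {ffun V -> K} -> T} :=
  [ffun z : {ffun V -> K} => f (mix A x z)].

Variables (V K T : finType) (f : {ffun V -> K} -> T) (A : {set V}).

Lemma row_ofE (x : V -> K) (z : {ffun V -> K}) : row_of f A x z = f (mix A x z).
Proof. by rewrite ffunE. Qed.

Lemma eq_row_ofP (x x' : V -> K) :
  (forall z : {ffun V -> K}, f (mix A x z) = f (mix A x' z)) <->
  row_of f A x = row_of f A x'.
Proof.
split=> [e|e z]; first by apply/ffunP=> z; rewrite !row_ofE.
by rewrite -!row_ofE e.
Qed.

(** Every partial assignment is the restriction of a total one, [c] filling the missing values.
    Pulling rows back along this restriction is therefore injective and preserves their number. *)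
Lemma nrowsE (c : K) :
  nrows (@Defs.comm_mx V K T f A) = #|[set row_of f A x | x : {ffun V -> K}]|.
Proof.
pose res (z : {ffun V -> K}) : {ffun {x | x \notin A} -> K} :=
  [ffun v => z (sval v)].
pose tot (g : {ffun {ffun {x | x \notin A} -> K} -> T}) :=
  [ffun z : {ffun V -> K} => g (res z)].
pose def (P : pred V) (y : {ffun {x | P x} -> K}) : {ffun V -> K} :=
  [ffun v => if insub v is Some u then y u else c].
have defE (P : pred V) y (v : {x | P x}) : def P y (sval v) = y v.
  by rewrite ffunE (valK v).
have tot_inj : injective tot.
  move=> g g' /ffunP e; apply/ffunP=> b.
  have := e (def _ b); rewrite !ffunE; suff -> : res (def _ b) = b by [].
  by apply/ffunP=> v; rewrite ffunE defE.
have glueE (a : {ffun {x | x \in A} -> K}) z :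
  glue a (res z) = mix A (def _ a) z.
  apply/ffunP=> v; rewrite !ffunE.
  case: {-}_/ boolP => vA; last by rewrite (negPf vA) ffunE.
  by rewrite vA -[LHS](defE _ a (exist _ v vA)) ffunE.
rewrite /nrows -(card_imset _ tot_inj); congr #|pred_of_set _|.
apply/setP=> r; apply/imsetP/imsetP.
  case=> _ /imsetP[a _ ->] ->; exists (def _ a) => //.
  by apply/ffunP=> z; rewrite !ffunE /Defs.comm_mx glueE.
case=> x _ ->; pose a : {ffun {x | x \in A} -> K} := [ffun v => x (sval v)].
exists [ffun b => Defs.comm_mx f a b]; first exact: imset_f.
apply/ffunP=> z; rewrite !ffunE /Defs.comm_mx glueE; congr f.
apply/ffunP=> v; rewrite !ffunE; case: ifP => // vA.
by rewrite insubT /= ffunE.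
Qed.

(** The row of [x] depends only on the code [phi x], so the set of rows lies in an image of [D]. *)
Lemma nrows_le (W : finType) (D : {set W}) (phi : {ffun V -> K} -> W) (c : K) :
  (forall x, phi x \in D) ->
  (forall x x' : {ffun V -> K}, phi x = phi x' ->
     forall z : {ffun V -> K}, f (mix A x z) = f (mix A x' z)) ->
  nrows (@Defs.comm_mx V K T f A) <= #|D|.
Proof.
move=> phiD phiE; rewrite (nrowsE c).
pose g w := if [pick x | phi x == w] is Some x then row_of f A x
            else row_of f A (fun=> c).
apply: leq_trans (leq_imset_card g D); apply: subset_leq_card.
apply/subsetP=> _ /imsetP[x _ ->]; apply/imsetP; exists (phi x) => //.
rewrite /g; case: pickP => [y /eqP e|/(_ x)]; last by rewrite eqxx.
exact/eq_row_ofP/phiE.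
Qed.

Lemma nrows_ge (W : finType) (D : {pred W}) (psi : W -> V -> K) (c : K) :
  {in D &, forall w w',
     (forall z : {ffun V -> K}, f (mix A (psi w) z) = f (mix A (psi w') z)) ->
     w = w'} ->
  #|D| <= nrows (@Defs.comm_mx V K T f A).
Proof.
move=> inj; rewrite (nrowsE c).
have /card_in_imset <- : {in D &, injective (fun w => row_of f A (psi w))}.
  by move=> w w' wD w'D /eq_row_ofP /inj; apply.
apply: subset_leq_card; apply/subsetP=> _ /imsetP[w _ ->].
apply/imsetP; exists [ffun v => psi w v] => //.
by apply/eq_row_ofP=> z; congr f; apply/ffunP=> v; rewrite !ffunE.
Qed.

End Rows.

(** Through [iota] the smaller matrix is a submatrix of the larger one, and cutting rows down to the
    columns [iota z] cannot create new ones. *)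
Lemma nrows_sub (V V' K T : finType) (f : {ffun V -> K} -> T)
    (f' : {ffun V' -> K} -> T) (A : {set V}) (A' : {set V'})
    (iota : {ffun V' -> K} -> {ffun V -> K}) (c : K) :
  (forall x z, f (mix A (iota x) (iota z)) = f' (mix A' x z)) ->
  nrows (@Defs.comm_mx V' K T f' A') <= nrows (@Defs.comm_mx V K T f A).
Proof.
move=> iotaE; rewrite !(nrowsE _ _ c).
pose res (g : {ffun {ffun V -> K} -> T}) :=
  [ffun z : {ffun V' -> K} => g (iota z)] : {ffun _ -> T}.
apply: leq_trans (leq_imset_card res [set row_of f A x | x : {ffun V -> K}]).
apply: subset_leq_card; apply/subsetP=> _ /imsetP[x _ ->].
apply/imsetP; exists (row_of f A (iota x)); first exact: imset_f.
by apply/ffunP=> z; rewrite !ffunE iotaE.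
Qed.

(** * Subtrees, restrictions and symmetry *)

Section Tree.
Set Implicit Arguments.
Unset Strict Implicit.
Variables (k : nat) (k_gt1 : 1 < k).
Implicit Types (d : nat) (E : {set 'I_k * 'I_k}).

Let c0 : 'I_k := Ordinal (ltnW k_gt1).
Let c1 : 'I_k := Ordinal k_gt1.

Let c01 : c0 != c1. Proof. by []. Qed.

Definition mvar d (p : 'I_k * 'I_k) : tree_var k d.+1 := inl p.
Definition lvar d (v : tree_var k d) : tree_var k d.+1 := inr (inl v).
Definition rvar d (v : tree_var k d) : tree_var k d.+1 := inr (inr v).

(** Polymorphic in [T], so that one case split builds assignments, membership predicates and
    [is_leaf]. *)
Definition node (T : Type) d (E : 'I_k * 'I_k -> T) (l r : tree_var k d -> T)
    (v : tree_var k d.+1) : T :=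
  match v with
  | inl p => E p
  | inr (inl w) => l w
  | inr (inr w) => r w
  end.

Definition node_set d (E : {set 'I_k * 'I_k}) (L R : {set tree_var k d}) :
    {set tree_var k d.+1} :=
  [set v | node (mem E) (mem L) (mem R) v].

Lemma node_setE d (A : {set tree_var k d.+1}) :
  A = node_set (@mvar d @^-1: A) (@lvar d @^-1: A) (@rvar d @^-1: A).
Proof. by apply/setP=> -[p|[v|v]]; rewrite inE /= inE. Qed.

Lemma card_node_set d E (L R : {set tree_var k d}) :
  #|node_set E L R| = #|E| + #|L| + #|R|.
Proof.
rewrite -!sum1_card big_sumType [X in _ + X = _]big_sumType addnA.
by congr (_ + _ + _); apply: eq_bigl => v; rewrite inE.
Qed.

Lemma eq_tree_eval d (x y : tree_var k d -> 'I_k) :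
  x =1 y -> tree_eval x = tree_eval y.
Proof.
elim: d x y => [|d IH] x y e /=; first exact: e.
by rewrite (IH _ _ (fun v => e (lvar v))) (IH _ _ (fun v => e (rvar v))) e.
Qed.

Lemma tree_eval_const d c : tree_eval (fun _ : tree_var k d => c) = c.
Proof. by case: d. Qed.

Definition rows d (A : {set tree_var k d}) : nat :=
  nrows (@Defs.comm_mx (tree_var k d) 'I_k 'I_k (@TEP k d.+1) A).

(** Takes plain functions, unlike [TEP], so that assignments built by [node] and restrictions such
    as [x \o @lvar d] can be used directly. *)
Definition tmix d (A : {set tree_var k d}) (x z : tree_var k d -> 'I_k) :=
  tree_eval (fun v => if v \in A then x v else z v).

Lemma TEP_mix d (A : {set tree_var k d}) x z :
  @TEP k d.+1 (mix A x z) = tmix A x z.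
Proof. by apply: eq_tree_eval => v; rewrite ffunE. Qed.

Lemma eq_tmix d (A : {set tree_var k d}) x x' z z' :
  x =1 x' -> z =1 z' -> tmix A x z = tmix A x' z'.
Proof. by move=> ex ez; apply: eq_tree_eval => v; rewrite ex ez. Qed.

Lemma tmix_node d E (L R : {set tree_var k d}) x z :
  let a := tmix L (x \o @lvar d) (z \o @lvar d) in
  let b := tmix R (x \o @rvar d) (z \o @rvar d) in
  tmix (node_set E L R) x z =
    if (a, b) \in E then x (mvar d (a, b)) else z (mvar d (a, b)).
Proof.
move=> a b; rewrite {1}/tmix /=.
rewrite (_ : tree_eval _ = a); last by apply: eq_tree_eval => v; rewrite !inE.
rewrite (_ : tree_eval _ = b); last by apply: eq_tree_eval => v; rewrite !inE.
by rewrite !inE.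
Qed.

Lemma tmixT d x z : tmix [set: tree_var k d] x z = tree_eval x.
Proof. by apply: eq_tree_eval => v; rewrite inE. Qed.

Lemma tmix0 d x z : tmix (set0 : {set tree_var k d}) x z = tree_eval z.
Proof. by apply: eq_tree_eval => v; rewrite inE. Qed.

Lemma rows_le d (A : {set tree_var k d}) (W : finType) (D : {set W})
    (phi : (tree_var k d -> 'I_k) -> W) :
  (forall x, phi x \in D) ->
  (forall x x', phi x = phi x' -> forall z, tmix A x z = tmix A x' z) ->
  rows A <= #|D|.
Proof.
move=> phiD phiE; apply: (nrows_le (phi := phi \o (fun x => x)) c0) => [x|x x'].
  exact: phiD.
by move=> /phiE e z; rewrite !TEP_mix.
Qed.

Lemma rows_ge d (A : {set tree_var k d}) (W : finType) (D : {pred W})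
    (psi : W -> tree_var k d -> 'I_k) :
  {in D &, forall w w',
     (forall z, tmix A (psi w) z = tmix A (psi w') z) -> w = w'} ->
  #|D| <= rows A.
Proof.
move=> psi_inj; apply: (nrows_ge (psi := psi) c0) => w w' wD w'D e.
apply: psi_inj => // z; have := e [ffun v => z v]; rewrite !TEP_mix.
have zE : [ffun v => z v] =1 z by move=> v; rewrite ffunE.
by rewrite !(eq_tmix _ (frefl _) zE).
Qed.

Lemma rows_sub d d' (A : {set tree_var k d}) (A' : {set tree_var k d'})
    (iota : (tree_var k d' -> 'I_k) -> tree_var k d -> 'I_k) :
  (forall x z, tmix A (iota x) (iota z) = tmix A' x z) -> rows A' <= rows A.
Proof.
move=> iotaE.
apply: (@nrows_sub _ _ _ _ (@TEP k d.+1) (@TEP k d'.+1) A A'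
          (fun x : {ffun _ -> _} => [ffun v => iota x v]) c0) => x z.
by rewrite !TEP_mix -iotaE; apply: eq_tmix => v; rewrite ffunE.
Qed.

(** Exchanging the subtrees while transposing the root matrix preserves the value. Later proofs use
    this to choose the side of a missing leaf. *)
Lemma rows_tr d E (L R : {set tree_var k d}) :
  rows (node_set [set p | (p.2, p.1) \in E] R L) <= rows (node_set E L R).
Proof.
apply: (rows_sub (iota := fun x =>
  node (fun p => x (mvar d (p.2, p.1))) (x \o @rvar d) (x \o @lvar d))) => x z.
by rewrite !tmix_node /= !inE.
Qed.

Lemma card_trset E :
  #|[set p | (p.2, p.1) \in E]| = #|E|.
Proof.
apply: (on_card_preimset (f := fun p => (p.2, p.1))).
by apply: onW_bij; exists (fun p => (p.2, p.1)) => -[].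
Qed.

(** With [fst] as its matrix, the root copies its left child. *)
Lemma rows_left d E (L R : {set tree_var k d}) :
  rows L <= rows (node_set E L R).
Proof.
apply: (rows_sub (iota := fun x => node fst x (fun=> c0))) => x z.
by rewrite tmix_node /= if_same.
Qed.

Lemma rows_right d E (L R : {set tree_var k d}) :
  rows R <= rows (node_set E L R).
Proof. by apply: leq_trans (rows_tr E L R); apply: rows_left. Qed.

(** * Upper bounds *)

(** The rows themselves form an optimal code, which a larger tree can use as a component of its own
    code. *)
Lemma rows_code d (A : {set tree_var k d}) :
  exists (W : finType) (D : {set W}) (phi : (tree_var k d -> 'I_k) -> W),
    [/\ #|D| = rows A, forall x, phi x \in D &
        forall x x', phi x = phi x' -> forall z, tmix A x z = tmix A x' z].
Proof.
exists _, [set row_of (@TEP k d.+1) A x | x : {ffun tree_var k d -> 'I_k}].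
exists (row_of (@TEP k d.+1) A); split=> [|x|x x' /eq_row_ofP e z].
- by rewrite /rows (nrowsE _ _ c0).
- apply/imsetP; exists [ffun v => x v] => //.
  by apply/eq_row_ofP => z; congr TEP; apply/ffunP=> v; rewrite !ffunE.
have := e [ffun v => z v]; rewrite !TEP_mix.
have zE : [ffun v => z v] =1 z by move=> v; rewrite ffunE.
by rewrite !(eq_tmix _ (frefl _) zE).
Qed.

Lemma rows_node_left d (L : {set tree_var k d}) :
  rows (node_set set0 L set0) <= rows L.
Proof.
have [W [D [phi [<- phiD phiE]]]] := rows_code L.
apply: (rows_le (phi := fun x => phi (x \o @lvar d))) => // x x' /phiE e z.
by rewrite !tmix_node !tmix0 e !inE.
Qed.

Lemma rows_node_right d (R : {set tree_var k d}) :
  rows (node_set set0 setT R) <= k * rows R.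
Proof.
have [W [D [phi [<- phiD phiE]]]] := rows_code R.
rewrite -[X in X * _]card_ord -cardsT -cardsX.
apply: (rows_le (phi := fun x =>
  (tree_eval (x \o @lvar d), phi (x \o @rvar d)))) => [x|x x' [el /phiE er] z].
  by rewrite inE /= inE phiD.
by rewrite !tmix_node !tmixT el er !inE.
Qed.

(** The left value selects a row of the root matrix; of the entries in [E], only those in that row
    can still be queried. *)
Lemma rows_node_row d E :
  rows (node_set E [set: tree_var k d] set0) <=
  \sum_(a : 'I_k) k ^ #|[set b | (a, b) \in E]|.
Proof.
(* A function equal to [c0] off the section records the entries read in row [q.1], so a section of
   size s contributes k^s codes. *)
pose D := [set q : 'I_k * {ffun 'I_k -> 'I_k} |
  q.2 \in pffun_on c0 [set b | (q.1, b) \in E] predT].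
have -> : \sum_(a : 'I_k) k ^ #|[set b | (a, b) \in E]| = #|D|.
  rewrite -sum1_card.
  rewrite (eq_bigl (fun q : 'I_k * {ffun 'I_k -> 'I_k} => predT q.1 &&
    (q.2 \in pffun_on c0 [set b | (q.1, b) \in E] predT))); last first.
    by move=> q; rewrite !inE.
  rewrite -(pair_big_dep predT (fun a (g : {ffun 'I_k -> 'I_k}) =>
    g \in pffun_on c0 [set b | (a, b) \in E] predT) (fun _ _ => 1)) /=.
  by apply: eq_bigr => a _; rewrite sum1_card card_pffun_on card_ord.
pose phi (x : tree_var k d.+1 -> 'I_k) :=
  let a := tree_eval (x \o @lvar d) in
  (a, [ffun b => if (a, b) \in E then x (mvar d (a, b)) else c0]).
apply: (rows_le (phi := phi)) => [x|x x' [el /ffunP e] z].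
  rewrite inE; apply/pffun_onP; split=> //.
  by apply/subsetP=> b; rewrite !inE ffunE; case: ifP => //; rewrite eqxx.
rewrite !tmix_node !tmixT !tmix0 -el.
by have := e (tree_eval (z \o @rvar d)); rewrite !ffunE -el; case: ifP.
Qed.

(* What is left of the root value once both subtrees are known: it is determined
   ([inl]), or it is an entry still to be read ([inr]). *)
Definition pending E : {set 'I_k + 'I_k * 'I_k} :=
  [set w | if w is inr p then p \notin E else true].

Lemma card_pending E : #|pending E| = k + (k ^ 2 - #|E|).
Proof.
rewrite -sum1_card big_sumType /= (eq_bigl predT); last first.
  by move=> a; rewrite inE.
rewrite (eq_bigl (mem (~: E))); last by move=> a; rewrite !inE.
by rewrite !sum1_card cardsCs setCK card_prod card_ord mulnn.
Qed.

Lemma rows_node_entries d E :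
  rows (node_set E [set: tree_var k d] setT) <= k + (k ^ 2 - #|E|).
Proof.
rewrite -card_pending.
pose phi (x : tree_var k d.+1 -> 'I_k) :=
  let p := (tree_eval (x \o @lvar d), tree_eval (x \o @rvar d)) in
  if p \in E then inl (x (mvar d p)) else inr p.
apply: (rows_le (phi := phi)) => [x|x x'].
  by rewrite inE /phi; case: ifP => // ->.
rewrite /phi => e z; rewrite !tmix_node !tmixT.
by move: e; case: ifP => pE; case: ifP => p'E //; [case=> ->|case=> <- <-].
Qed.

Lemma rows_leaf (A : {set tree_var k 0}) : rows A <= k.
Proof.
rewrite -[X in _ <= X]card_ord -cardsT.
apply: (rows_le (phi := fun x : tree_var k 0 -> _ => x tt)) => [x|x x' e z].
  by rewrite inE.
by rewrite /tmix /= e.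
Qed.

Lemma exists_entries n : n <= k ^ 2 -> exists E, #|E| = n.
Proof.
move=> nk; have [|E _ cE] := exists_subset [set: 'I_k * 'I_k] n; last first.
  by exists E.
by rewrite cardsT card_prod card_ord mulnn.
Qed.

(** The witnessing sets are kept because [narrow_step] places them inside a larger tree. *)
Definition narrow d N :=
  forall l, l <= #|tree_var k d| ->
  exists2 A : {set tree_var k d}, #|A| = l & rows A <= N.

Lemma card_tree_var d :
  #|tree_var k d.+1| = k ^ 2 + (#|tree_var k d| + #|tree_var k d|).
Proof. by rewrite !card_sum card_prod card_ord mulnn. Qed.

Lemma narrow_S_max d N : narrow d N -> S_max (@TEP k d.+1) <= N.
Proof.
move=> nar; apply/bigmax_leqP_seq => l.
rewrite mem_index_iota ltnS => /andP[_ lV] _.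
have [A cA] := nar _ lV; apply: leq_trans.
have k_gt0 : 0 < #|'I_k| by rewrite card_ord ltnW.
by have [_] := S_atP (@TEP k d.+1) k_gt0 lV; apply.
Qed.

(** The three inequalities pay for the three ranges of [l]: ending in the left subtree, in the right
    one, or in the root matrix. *)
Lemma narrow_step d N N' :
  narrow d N -> N <= N' -> k * N <= N' -> k + k ^ 2 <= N' -> narrow d.+1 N'.
Proof.
move=> nar NN' kNN' kkN' l; rewrite card_tree_var => lV.
have [lT|lT] := leqP l #|tree_var k d|.
  have [A cA rA] := nar _ lT; exists (node_set set0 A set0).
    by rewrite card_node_set !cards0 addn0.
  exact: leq_trans (leq_trans (rows_node_left A) rA) NN'.
have [lTT|lTT] := leqP l (#|tree_var k d| + #|tree_var k d|).
  have [|A cA rA] := nar (l - #|tree_var k d|); first by lia.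
  exists (node_set set0 setT A).
    by rewrite card_node_set cards0 cardsT; lia.
  apply: leq_trans (rows_node_right A) (leq_trans _ kNN').
  by rewrite leq_mul2l rA orbT.
have [|E cE] := @exists_entries (l - (#|tree_var k d| + #|tree_var k d|)).
  by lia.
exists (node_set E setT setT); first by rewrite card_node_set !cardsT cE; lia.
by apply: leq_trans (rows_node_entries d E) _; rewrite cE; lia.
Qed.

Lemma card_section E (B : {set 'I_k}) (a : 'I_k) :
  (forall b, (a, b) \in E -> b \in B) ->
  k ^ #|[set b | (a, b) \in E]| <= k ^ #|B|.
Proof.
move=> EB; rewrite leq_exp2l //; apply: subset_leq_card.
by apply/subsetP=> b; rewrite inE; apply: EB.
Qed.

Lemma narrow2 : narrow 1 (k ^ 2).
Proof.
move=> l; rewrite card_tree_var !card_unit => lV.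
have [->|l_gt0] := posnP l.
  exists (node_set set0 set0 set0); first by rewrite card_node_set !cards0.
  apply: leq_trans (rows_node_left _) (leq_trans (rows_leaf _) _).
  by rewrite -mulnn leq_pmull // ltnW.
(* The left leaf and entries of the single column [c0]: at most one entry per row, hence at most k *
   k rows. *)
have [lk|lk] := leqP l k.+1.
  have [|E EB cE] := exists_subset (setX [set: 'I_k] [set c0]) l.-1.
    by rewrite cardsX cards1 cardsT card_ord; lia.
  exists (node_set E setT set0).
    by rewrite card_node_set cards0 cardsT card_unit cE; lia.
  apply: leq_trans (rows_node_row _ E) _.
  rewrite (@leq_trans (\sum_(a < k) k ^ #|[set c0]|)) //.
    apply: leq_sum => a _; apply: card_section => b /(subsetP EB).
    by rewrite !inE.
  by rewrite cards1 sum_nat_const card_ord mulnn.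
(* At least k entries are read now, which absorbs the summand k in k + (k^2 - |E|). *)
have [|E cE] := @exists_entries (l - 2); first by lia.
exists (node_set E setT setT).
  by rewrite card_node_set !cardsT card_unit cE; lia.
by apply: leq_trans (rows_node_entries 0 E) _; rewrite cE; lia.
Qed.

Lemma narrow3 : narrow 2 (k * (k ^ 2 - k + 2)).
Proof.
have kk : k <= k ^ 2 by rewrite -mulnn leq_pmull // ltnW.
move=> l; rewrite !card_tree_var !card_unit => lV.
have [lT|lT] := leqP l (k ^ 2 + 2).
  have [|A cA rA] := @narrow2 l; first by rewrite card_tree_var !card_unit.
  exists (node_set set0 A set0); first by rewrite card_node_set !cards0 addn0.
  apply: leq_trans (leq_trans (rows_node_left A) rA) _.
  by rewrite -mulnn in kk *; nia.
have [lE|lE] := ltnP l (k ^ 2 + 2 + 2 * k).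
  (* Just past the left subtree, root entries, at most two per row, are cheaper
     than entering the right subtree. *)
  pose E0 : {set 'I_k * 'I_k} := setX setT [set c0; c1].
  have cE0 : #|E0| = k * 2 by rewrite cardsX cardsT card_ord cards2 c01.
  have cE1 : #|E0 :\ (c0, c1)| = k * 2 - 1.
    have := cardsD1 (c0, c1) E0; rewrite cE0 !inE eqxx orbT add1n => ->.
    by rewrite subn1.
  have [|E EB cE] := exists_subset (E0 :\ (c0, c1)) (l - (k ^ 2 + 2)).
    by rewrite cE1; lia.
  exists (node_set E setT set0).
    by rewrite card_node_set cards0 cardsT card_tree_var !card_unit cE; lia.
  apply: leq_trans (rows_node_row _ E) _; rewrite (bigD1 c0) //=.
  apply: (@leq_trans (k ^ #|[set c0]| +
                      \sum_(a < k | a != c0) k ^ #|[set c0; c1]|)).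
    apply: leq_add.
      apply: card_section => b /(subsetP EB).
      by rewrite !inE /= => /andP[/[swap]/orP[//|/eqP->]]; rewrite eqxx.
    apply: leq_sum => a _; apply: card_section => b /(subsetP EB).
    by rewrite !inE => /andP[].
  rewrite cards1 cards2 c01 sum_nat_const cardC1 card_ord.
  by rewrite -!mulnn in kk *; nia.
have [lTT|lTT] := leqP l (k ^ 2 + 2 + (k ^ 2 + 2)).
  (* By [lE] at least 2k - 2 entries of the right matrix are read, and k + k^2 - (2k - 2) is exactly
     the factor k^2 - k + 2. *)
  have [|E cE] := @exists_entries (l - (k ^ 2 + 2) - 2); first by lia.
  exists (node_set set0 setT (node_set E setT setT)).
    rewrite !card_node_set cards0 !cardsT card_tree_var !card_unit cE.
    by rewrite -mulnn in kk lE *; nia.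
  apply: leq_trans (rows_node_right _) _; rewrite leq_mul2l; apply/orP; right.
  by apply: leq_trans (rows_node_entries 0 E) _; rewrite cE; lia.
have [|E cE] := @exists_entries (l - (k ^ 2 + 2 + (k ^ 2 + 2))); first by lia.
exists (node_set E setT setT).
  by rewrite card_node_set !cardsT card_tree_var !card_unit cE; lia.
apply: leq_trans (rows_node_entries 1 E) _.
by rewrite cE; rewrite -mulnn in kk lE lTT *; nia.
Qed.

(** For h = d + 3 the bound is k^h - k^(h-2) (k - 2); each level above height 3 costs a factor k. *)
Lemma narrow_tree d : narrow d.+2 (k ^ d.+1 * (k ^ 2 - k + 2)).
Proof.
elim: d => [|d IH]; first by rewrite expn1; exact: narrow3.
have kd : 0 < k ^ d by rewrite expn_gt0 ltnW.
apply: narrow_step IH _ _ _.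
- by rewrite leq_mul2r leq_exp2l // leqnSn orbT.
- by rewrite mulnA -expnS.
- have kk : k <= k ^ 2 by rewrite -mulnn leq_pmull // ltnW.
  rewrite (expnS k d.+1) (expnS k d) -!mulnA; rewrite -mulnn in kk *.
  apply: (@leq_trans (k * (k * (k * k - k + 2)))); first by nia.
  by rewrite !leq_mul2l leq_pmull ?orbT.
Qed.

(** * Lower bounds *)

Definition other (c : 'I_k) : 'I_k := if c == c0 then c1 else c0.

Lemma otherP c : other c != c.
Proof. by rewrite /other; case: (eqVneq c c0) => [->|]; rewrite eq_sym. Qed.

Fixpoint is_leaf d : tree_var k d -> bool :=
  match d with
  | 0 => fun=> true
  | d'.+1 => node (fun=> false) (@is_leaf d') (@is_leaf d')
  end.

(** The matrices on the path from the root to [v] are projections towards [v], so the label of [v]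
    is copied up to the root. *)
Lemma leaf_selector d (v : tree_var k d) : is_leaf v ->
  exists2 q : 'I_k -> tree_var k d -> 'I_k,
    forall c, tree_eval (q c) = c & forall c c' w, w != v -> q c w = q c' w.
Proof.
elim: d v => [|d IH] [] //; first by exists (fun c _ => c) => // c c' [].
case=> v lv; have [q qE qv] := IH v lv.
  exists (fun c => node fst (q c) (fun=> c0)) => [c|c c' [p|[w|w]]] //=.
  by move=> wv; apply: qv; apply: contraNneq wv => ->.
exists (fun c => node snd (fun=> c0) (q c)) => [c|c c' [p|[w|w]]] //=.
by move=> wv; apply: qv; apply: contraNneq wv => ->.
Qed.

Lemma rows_section d E (L R : {set tree_var k d}) v a :
  is_leaf v -> v \notin R ->
  k ^ #|[set b | (a, b) \in E]| <= rows (node_set E L R).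
Proof.
move=> /leaf_selector[q qE qv] vR.
rewrite -[X in X ^ _]card_ord -(card_pffun_on c0 _ predT).
apply: (rows_ge (psi := fun g : {ffun 'I_k -> 'I_k} =>
  node (fun p => g p.2) (fun=> a) (q c0))) => g g' gE g'E e.
apply/ffunP=> b; have := e (node (fun=> c0) (fun=> a) (q b)).
have La : tmix L (fun=> a) (fun=> a) = a.
  rewrite -[RHS](tree_eval_const d); apply: eq_tree_eval => w.
  by rewrite if_same.
(* [q c0] and [q b] differ at most at [v], which lies outside [R], so the column alone steers the
   right value to any b. *)
have Rb : tmix R (q c0) (q b) = b.
  rewrite -[RHS]qE; apply: eq_tree_eval => w; case: ifP => // wR.
  by apply: qv; apply: contraTneq wR => ->.
rewrite !tmix_node /= [tmix L _ _]La [tmix R _ _]Rb; case: ifP => // abE _.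
have out h : h \in pffun_on c0 [set b | (a, b) \in E] predT -> h b = c0.
  move=> /pffun_onP[/subsetP hE _]; apply/eqP; apply: contraFT abE => hb.
  by have := hE b hb; rewrite inE.
by rewrite !out.
Qed.

Lemma sum_card_sections E : \sum_(a : 'I_k) #|[set b | (a, b) \in E]| = #|E|.
Proof.
rewrite -[RHS]sum1_card (eq_bigl (fun p => predT p.1 && ((p.1, p.2) \in E))).
  rewrite -(pair_big_dep predT (fun a b => (a, b) \in E) (fun _ _ => 1)) /=.
  apply: eq_bigr => a _; rewrite -sum1_card.
  by apply: eq_bigl => b; rewrite inE.
by case.
Qed.

Lemma big_section E t : t * k < #|E| -> exists a, t < #|[set b | (a, b) \in E]|.
Proof.
move=> tE; apply/existsP; apply: contraLR tE => /existsPn small.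
rewrite -leqNgt.
rewrite -sum_card_sections mulnC -[X in _ <= X * _]card_ord -sum_nat_const.
by apply: leq_sum => a _; rewrite leqNgt.
Qed.

Lemma rows_many_entries d E (L R : {set tree_var k d}) v t :
  is_leaf v -> (v \notin L) || (v \notin R) -> t * k < #|E| ->
  k ^ t.+1 <= rows (node_set E L R).
Proof.
move=> lv; wlog vR : E L R / v \notin R => [hw|_].
  case/orP=> [vL|vR]; last by apply: (hw _ _ _ vR); rewrite vR orbT.
  rewrite -card_trset => tE; apply: leq_trans (rows_tr E L R).
  by apply: hw => //; rewrite vL orbT.
move=> /big_section[a ta]; apply: leq_trans (rows_section _ _ a lv vR).
by rewrite leq_exp2l.
Qed.

(** The row reveals both the left value [a] and the content [m] of the one read entry in row [a]:
    equal left values are compared at that entry, different ones at an unread entry, which exists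
    since k > 1. *)
Lemma rows_unit_sections d E : (forall a, #|[set b | (a, b) \in E]| = 1) ->
  k ^ 2 <= rows (node_set E [set: tree_var k d] set0).
Proof.
move=> E1; rewrite -mulnn -[k in k * k]card_ord -card_prod.
apply: (rows_ge (psi := fun w : 'I_k * 'I_k =>
  node (fun=> w.2) (fun=> w.1) (fun=> c0))) => -[a m] [a' m'] _ _ e.
have {}e zeta b : (if (a, b) \in E then m else zeta (a, b)) =
                  (if (a', b) \in E then m' else zeta (a', b)).
  have := e (node zeta (fun=> c0) (fun=> b)).
  by rewrite !tmix_node !tmixT !tmix0 /= !tree_eval_const.
have [aa'|aa'] := eqVneq a a'.
  rewrite -aa' in e *.
  have /card_gt0P[b] : 0 < #|[set b | (a, b) \in E]| by rewrite E1.
  by rewrite inE => abE; have := e (fun=> c0) b; rewrite abE => ->.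
have [b] : exists b, b \notin [set b | (a, b) \in E].
  apply/existsP; apply: contraT => /existsPn full.
  have := E1 a; rewrite (_ : [set b | _] = setT) ?cardsT ?card_ord; last first.
    by apply/setP=> b; have := full b; rewrite negbK in_setT.
  by move=> k1; move: k_gt1; rewrite k1.
rewrite inE => abE; set u := if (a', b) \in E then m' else c0.
(* From [a'] the value in column [b] is [u]; the unread entry (a, b) is set to something else. *)
have := e (fun p => if p == (a, b) then other u else c0) b.
rewrite (negPf abE) eqxx xpair_eqE eq_sym (negPf aa') /= -/u => /eqP.
by rewrite (negPf (otherP u)).
Qed.

(** Converse of [rows_node_entries]: querying the read entry [e0] yields the k constant rows, and
    each unread position yields a row that returns its entry. *)
Lemma rows_both_subtrees d E : E != set0 ->
  k + (k ^ 2 - #|E|) <= rows (node_set E [set: tree_var k d] setT).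
Proof.
case/set0Pn=> e0 e0E; rewrite -card_pending.
apply: (rows_ge (psi := fun w => match w with
  | inl c => node (fun=> c) (fun=> e0.1) (fun=> e0.2)
  | inr p => node (fun=> c0) (fun=> p.1) (fun=> p.2) end)) => w w' wE w'E e.
have {}e zeta : match w with inl c => c | inr p => zeta p end =
                match w' with inl c => c | inr p => zeta p end.
  have := e (node zeta (fun=> c0) (fun=> c0)); rewrite !tmix_node !tmixT.
  case: w w' wE w'E {e} => [c|p] [c'|p'];
    rewrite !inE /= !tree_eval_const -!surjective_pairing ?e0E //.
  - by move=> _ /negPf->.
  - by move=> /negPf->.
  - by move=> /negPf-> /negPf->.
case: w w' e {wE w'E} => [c|p] [c'|p'] e.
- by rewrite (e (fun=> c0)).
- by have /eqP := e (fun=> other c); rewrite eq_sym (negPf (otherP c)).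
- by have /eqP := e (fun=> other c'); rewrite (negPf (otherP c')).
- have := e (fun q => if q == p then c1 else c0); rewrite eqxx.
  by case: eqVneq => [->|].
Qed.

Lemma leaf_setP (L : {set tree_var k 0}) : tt \notin L /\ L = set0 \/ L = setT.
Proof.
case: (boolP (tt \in L)) => ttL; [right | left; split=> //];
  by apply/setP=> -[]; rewrite inE ?(negPf ttL).
Qed.

Lemma rows2_ge (A : {set tree_var k 1}) :
  k + 1 <= #|A| <= k + 2 -> k ^ 2 <= rows A.
Proof.
rewrite (node_setE A).
set E := _ @^-1: A; set L := _ @^-1: A; set R := _ @^-1: A.
rewrite card_node_set.
(* Up to symmetry, either the right leaf is missing or both leaves are read. *)
wlog : E L R / R = set0 \/ L = setT /\ R = setT => [hw cA|].
  have [[_ R0]|RT] := leaf_setP R; first by apply: hw cA; left.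
  have [[_ L0]|LT] := leaf_setP L; last by apply: hw cA; right.
  apply: leq_trans (rows_tr E L R); apply: hw; first by left.
  by rewrite card_trset addnAC.
case=> [->|[-> ->]].
  rewrite cards0 addn0 => /andP[cA _].
  (* Two read entries in one row already give k^2 rows. Otherwise |E| <= k, and the size of [A]
     forces the left leaf into it and exactly one entry in each row. *)
  have [a aE|le1] := pickP (fun a => 1 < #|[set b | (a, b) \in E]|).
    apply: leq_trans (rows_section E L a (isT : @is_leaf 0 tt) _); last first.
      by rewrite inE.
    by rewrite leq_exp2l.
  have Ek : #|E| <= k.
    rewrite leqNgt; apply/negP; rewrite -{1}[k]mul1n => /big_section[a].
    by rewrite le1.
  have [[_ L0]|LT] := leaf_setP L.
    by move: cA; rewrite L0 cards0 addn0 addn1 ltnNge Ek.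
  move: cA; rewrite LT cardsT card_unit leq_add2r => kE.
  apply: rows_unit_sections => a.
  have sumE : \sum_(a : 'I_k) #|[set b | (a, b) \in E]| == \sum_(a : 'I_k) 1.
    by rewrite sum_card_sections sum1_card card_ord eqn_leq Ek kE.
  have le1' (b : 'I_k) : true -> #|[set c | (b, c) \in E]| <= 1 ?= iff
      (#|[set c | (b, c) \in E]| == 1).
    by move=> _; apply: leqif_eq; rewrite leqNgt le1.
  by move: sumE; rewrite (leqif_sum le1') => /forall_inP/(_ a isT)/eqP.
(* Now k - 1 <= |E| <= k: [E] is nonempty, and k + (k^2 - |E|) >= k^2. *)
rewrite !cardsT card_unit !leq_add2r addn2 => /andP[].
move: #|E| (@rows_both_subtrees 0 E) (card_gt0 E) => n rE E0.
move=> nk nk2; apply: leq_trans (rE _); first by rewrite -mulnn in rE *; nia.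
by rewrite -E0; lia.
Qed.

(** The row writes any left value into the read entry [e] and points the right leaves at an entry
    outside [G]. Row and column both carry [M], so the root evaluates as [M] for every [E]. *)
Lemma rows_root d E (F G : {set 'I_k * 'I_k}) e : e \in F ->
  k * (k ^ 2 - #|G|) <=
  rows (node_set E (node_set F [set: tree_var k d] setT)
                   (node_set G setT setT)).
Proof.
move=> eF.
have -> : k * (k ^ 2 - #|G|) = #|setX [set: 'I_k] (~: G)|.
  by rewrite cardsX cardsT [#|~: G|]cardsCs setCK card_prod !card_ord mulnn.
(* [M] makes column [c0] reveal the left value, and [c1] reveal which entry of
   the right matrix was queried. *)
pose M (p : 'I_k * 'I_k) := if p.2 == c0 then p.1 else other p.1.
apply: (rows_ge (psi := fun w : 'I_k * ('I_k * 'I_k) =>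
  node M (node (fun=> w.1) (fun=> e.1) (fun=> e.2))
         (node (fun=> c0) (fun=> w.2.1) (fun=> w.2.2)))).
move=> [a p] [a' p']; rewrite !inE /= => pG p'G eq_rows.
have {}eq_rows zeta : M (a, zeta p) = M (a', zeta p').
  have := eq_rows (node M (fun=> c0) (node zeta (fun=> c0) (fun=> c0))).
  rewrite !tmix_node !tmixT /= !tree_eval_const -!surjective_pairing eF.
  by rewrite (negPf pG) (negPf p'G) !if_same.
have aa' : a = a' := eq_rows (fun=> c0).
rewrite -aa' in eq_rows *; congr (_, _).
have := eq_rows (fun q => if q == p then c1 else c0).
rewrite /M /= eqxx /=; case: (eqVneq p' p) => // _ /= /eqP.
by rewrite (negPf (otherP a)).
Qed.

Lemma leaf_set_pairP (L R : {set tree_var k 0}) :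
  (tt \notin L) || (tt \notin R) /\ #|L| + #|R| <= 1 \/
  [/\ L = setT, R = setT & #|L| + #|R| = 2].
Proof.
have [[ttL ->]|->] := leaf_setP L; have [[ttR ->]|->] := leaf_setP R;
  rewrite ?inE ?cards0 ?cardsT ?card_unit; by [left | right].
Qed.

Lemma rows3_ge (A : {set tree_var k 2}) t :
  0 < t <= k -> 16 * t <= 7 * k -> k ^ 3 <= 16 * k ^ t.+1 ->
  #|A| = k ^ 2 + 2 * t * k + 4 -> k ^ 3 <= 16 * rows A.
Proof.
move=> /andP[t_gt0 tk] tk' kt cA.
have [big|small] := leqP (k ^ t.+1) (rows A).
  by apply: leq_trans kt _; rewrite leq_mul2l big orbT.
move: cA small; rewrite (node_setE A).
move: (_ @^-1: A) (_ @^-1: A) (_ @^-1: A) => R L E {A}.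
rewrite (node_setE L) (node_setE R).
move: (_ @^-1: L) (_ @^-1: L) (_ @^-1: L) => X2 X1 F {L}.
move: (_ @^-1: R) (_ @^-1: R) (_ @^-1: R) => Y2 Y1 G {R}.
rewrite !card_node_set.
set L := node_set F _ _; set R := node_set G _ _ => cA small.
have fewE v : is_leaf v -> (v \notin L) || (v \notin R) -> #|E| <= t * k.
  move=> lv vLR; rewrite leqNgt; apply/negP=> /(rows_many_entries lv vLR).
  by rewrite leqNgt small.
have fewF : (tt \notin X1) || (tt \notin X2) -> #|F| <= t * k /\ #|E| <= t * k.
  move=> ttX; split.
    rewrite leqNgt; apply/negP=> /(rows_many_entries (isT : @is_leaf 0 tt) ttX).
    by move=> /leq_trans/(_ (rows_left E L R)); rewrite leqNgt small.
  case/orP: ttX => ttX; [apply: (fewE (lvar (tt : tree_var k 0))) |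
                         apply: (fewE (rvar (tt : tree_var k 0)))] => //;
    by rewrite inE /= ttX.
have fewG : (tt \notin Y1) || (tt \notin Y2) -> #|G| <= t * k /\ #|E| <= t * k.
  move=> ttX; split.
    rewrite leqNgt; apply/negP=> /(rows_many_entries (isT : @is_leaf 0 tt) ttX).
    by move=> /leq_trans/(_ (rows_right E L R)); rewrite leqNgt small.
  case/orP: ttX => ttX; [apply: (fewE (lvar (tt : tree_var k 0))) |
                         apply: (fewE (rvar (tt : tree_var k 0)))] => //;
    by apply/orP; right; rewrite inE /= ttX.
have tkk : 16 * (t * k) <= 7 * (k * k) by rewrite !mulnA leq_mul2r tk' orbT.
have tkk' : t * k <= k * k by rewrite leq_mul2r tk orbT.
have tk_gt0 : 0 < t * k by rewrite muln_gt0 t_gt0 ltnW.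
have max_card2 (B : {set 'I_k * 'I_k}) : #|B| <= k * k.
  by apply: leq_trans (max_card _) _; rewrite card_prod card_ord.
have rootF : X1 = setT -> X2 = setT -> Y1 = setT -> Y2 = setT -> 0 < #|F| ->
    k * (k ^ 2 - #|G|) <= rows (node_set E L R).
  rewrite /L /R => -> -> -> -> /card_gt0P[e eF]; exact: (@rows_root 0 E F G e).
have rootG : X1 = setT -> X2 = setT -> Y1 = setT -> Y2 = setT -> 0 < #|G| ->
    k * (k ^ 2 - #|F|) <= rows (node_set E L R).
  rewrite /L /R => -> -> -> -> /card_gt0P[e eG].
  apply: leq_trans (rows_tr E _ _); exact: (@rows_root 0 _ G F e).
(* The smaller part satisfies g <= k^2/2 + tk <= (1/2 + 7/16) k^2, so at least k^2/16 positions stay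
   unread; this is the source of 16 t <= 7 k. *)
have half e f g N : e <= k * k -> g <= f -> e + f + g = k ^ 2 + 2 * t * k ->
    (0 < f -> k * (k ^ 2 - g) <= N) -> k ^ 3 <= 16 * N.
  move=> ek gf efg rN; have {}rN : k * (k ^ 2 - g) <= N by apply: rN; lia.
  apply: leq_trans (_ : 16 * (k * (k ^ 2 - g)) <= _).
    by rewrite expnS mulnCA leq_mul2l; apply/orP; right; lia.
  by rewrite leq_mul2l rN.
move: cA (max_card2 F) (max_card2 G) (max_card2 E).
case: (leaf_set_pairP X1 X2) => [[/fewF[]]|[X1T X2T]];
  case: (leaf_set_pairP Y1 Y2) => [[/fewG[]]|[Y1T Y2T]].
4: move: (rootF X1T X2T Y1T Y2T) (rootG X1T X2T Y1T Y2T).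
all: move: #|E| #|F| #|G| #|X1| #|X2| #|Y1| #|Y2| (rows _).
all: clear -k_gt1 tkk tkk' tk_gt0 half; rewrite -mulnn -?mulnA in half *.
(* A missing leaf on one side only leaves room for k^2 + 2tk entries and three leaves, one short of
   |A|; with leaves missing on both sides, 3tk entries and two leaves are too few since t <= k. *)
1-3: move=> e f g x1 x2 y1 y2 N; lia.
move=> e f g x1 x2 y1 y2 N rF rG cY cX cA fk gk ek.
have [gf|/ltnW fg] := leqP g f; first by apply: (half e f g); lia.
by apply: (half e g f); lia.
Qed.

(** * From row counts to [S_at] and [S_max] *)

Lemma S_at_ge d l n : l <= #|tree_var k d| ->
  (forall A : {set tree_var k d}, #|A| = l -> n <= rows A) ->
  n <= S_at (@TEP k d.+1) l.
Proof.
move=> lV rA; have k_gt0 : 0 < #|'I_k| by rewrite card_ord ltnW.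
by have [[A cA ->] _] := S_atP (@TEP k d.+1) k_gt0 lV; apply: rA.
Qed.

Lemma S_at_le_max d l : 0 < l <= #|tree_var k d| ->
  S_at (@TEP k d.+1) l <= S_max (@TEP k d.+1).
Proof.
by move=> lV; apply: leq_bigmax_seq => //; rewrite mem_index_iota ltnS.
Qed.

Lemma S2 l : k + 1 <= l <= k + 2 ->
  S_at (@TEP k 2) l = k ^ 2 /\ S_max (@TEP k 2) = k ^ 2.
Proof.
move=> kl.
have lV : 0 < l <= #|tree_var k 1|.
  by rewrite card_tree_var !card_unit; move: kl k_gt1; nia.
have ge : k ^ 2 <= S_at (@TEP k 2) l.
  have [_ lV'] := andP lV.
  by apply: S_at_ge lV' _ => A cA; apply: rows2_ge; rewrite cA.
have le_max := S_at_le_max lV; have max_le := narrow_S_max narrow2.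
split; apply/eqP; rewrite eqn_leq.
  by rewrite ge (leq_trans le_max max_le).
by rewrite (leq_trans ge le_max) andbT; exact: max_le.
Qed.

Lemma S3_ge : 4 <= k -> k ^ 3 <= 16 * S_max (@TEP k 3).
Proof.
(* For [k = 4] the choice [t = 2] would violate [16 * t <= 7 * k]. *)
move=> k4; pose t := if k == 4 then 1 else 2.
have kt : k ^ 3 <= 16 * k ^ t.+1.
  rewrite /t; case: eqP => [->//|_]; exact: leq_pmull.
have t_bounds : 0 < t <= k /\ 16 * t <= 7 * k.
  by rewrite /t; case: eqP; lia.
have [tk tk'] := t_bounds.
have lV : 0 < k ^ 2 + 2 * t * k + 4 <= #|tree_var k 2|.
  by rewrite !card_tree_var !card_unit -mulnn; move: tk; nia.
apply: leq_trans (_ : 16 * S_at (@TEP k 3) (k ^ 2 + 2 * t * k + 4) <= _); last first.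
  by rewrite leq_mul2l S_at_le_max.
have [_ lV'] := andP lV; have k_gt0 : 0 < #|'I_k| by rewrite card_ord ltnW.
have [[A cA ->] _] := S_atP (@TEP k 3) k_gt0 lV'.
exact: (@rows3_ge A t).
Qed.

Lemma S_max_le h : 3 <= h ->
  S_max (@TEP k h) <= k ^ h - k ^ (h - 2) * (k - 2).
Proof.
case: h => [|[|[|d]]] // _; rewrite !subSS subn0.
have -> : k ^ d.+3 - k ^ d.+1 * (k - 2) = k ^ d.+1 * (k ^ 2 - k + 2).
  rewrite -(addn2 d.+1) expnD -mulnBr -mulnn; congr (_ * _).
  by move: k_gt1; nia.
by apply: (@narrow_S_max d.+2); apply: narrow_tree.
Qed.

End Tree.

Theorem theorem4p4 (k : nat) (hk : 2 <= k) :
  (* (1) *)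
  [/\ S_max (@TEP k 2) = k ^ 2,
      S_at (@TEP k 2) (k + 1) = k ^ 2 &
      S_at (@TEP k 2) (k + 2) = k ^ 2] /\
  (* (2) *)
  (4 <= k -> ((k ^ 3)%:R / 16%:R <= (S_max (@TEP k 3))%:R :> rat)%R) /\
  (* (3) *)
  (forall h : nat, 3 <= h ->
     S_max (@TEP k h) <= k ^ h - k ^ (h - 2) * (k - 2)) /\
  (forall h : nat, 3 <= h -> 3 <= k -> S_max (@TEP k h) < k ^ h).
Proof.
have k12 : k + 1 <= k + 2 by rewrite leq_add2l.
split; last split; last split.
- have [|-> ->] := @S2 k hk (k + 1); first by rewrite leqnn k12.
  by have [|-> _] := @S2 k hk (k + 2); first by rewrite leqnn k12.
- move=> k4; rewrite Num.Theory.ler_pdivrMr ?Num.Theory.ltr0n //.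
  by rewrite -GRing.natrM Num.Theory.ler_nat mulnC; apply: S3_ge.
- exact: S_max_le.
move=> h h3 k3; apply: leq_ltn_trans (S_max_le hk h3) _.
by rewrite ltn_subrL muln_gt0 !expn_gt0 subn_gt0 k3 ltnW.
Qed.
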